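(* Let $N,n,m,p$ be positive integers, $A\in\mathbb R^{n\times n}$, $B\in\mathbb R^{n\times m}$, $C\in\mathbb R^{p\times n}$, $\Sigma=(A,B,C)$. Suppose that: a) $(\hat P,\hat{\mathcal J},\hat{\mathcal G})$ is a solution of the state-feedback LMI $$\mathcal X_N(P,1)+\mathrm{He}\left\{(\mathcal L_N^T\otimes A)\mathcal G(\mathcal R_N\otimes\mathbf I_n)+(\mathcal L_N^T\otimes B)\mathcal J(\mathcal R_N\otimes\mathbf I_n)-(\mathcal R_N^T\otimes\mathbf I_n)\mathcal G(\mathcal R_N\otimes\mathbf I_n)\right\}\prec0$$ in the unknowns $P=P^T\in\mathbb R^{n\times n}$, $\mathcal J\in\mathbb R^{Nm\times Nn}$ block upper triangular with $m\times n$ blocks, and $\mathcal G\in\mathbb R^{Nn\times Nn}$ block upper triangular with $n\times n$ blocks, and $\hat{\mathcal F}_{\mathrm{SF}}=(\mathbf T_N\otimes\mathbf I_m)\hat{\mathcal J}\hat{\mathcal G}^{-1}(\mathbf T_N\otimes\mathbf I_n)$; b) $\mathcal P\bigl(\mathcal A_{\mathrm{LTI}}(\hat{\mathcal F}_{\mathrm{SF}},\Sigma)\bigr)\cap\mathcal S_{\mathrm{SOF}}^{(N)}(\Sigma)\neq\emptyset$. Then there exists a structured output-feedback gain matrix $\mathcal F_{\mathrm{SOF}}\in\mathbb R^{Nm\times Np}$ such that the $N$-periodic closed-loop system $$x(k+1)=Ax(k)+B\sum_{i=0}^{\lceil k\rceil_N}F_{\mathrm{SOF}}^{(\lceil k\rceil_N,i)}Cx(k-i),\quad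 k\in\mathbb N,$$ (equivalently, the LTI system $\phi(t+1)=\mathcal A_{\mathrm{LTI}}(\mathcal F_{\mathrm{SOF}},\Sigma)\phi(t)$, $t\in\mathbb N$, with $\phi(t)=x(Nt)$) is asymptotically stable if and only if there exist $P=P^T\in\mathbb R^{n\times n}$, $\mathcal V\in\mathbb R^{((N-1)n+Nm)\times((N-1)n+Nm)}$ and a structured output-feedback gain matrix $\mathcal F_{\mathrm{SOF}}\in\mathbb R^{Nm\times Np}$ such that $$P\succ0,\qquad \Pi_N^T\,\mathcal X_N(P,1)\,\Pi_N+\mathrm{He}\{\mathcal H(\hat{\mathcal F}_{\mathrm{SF}})^T\,\mathcal V\,\mathcal C(\mathcal F_{\mathrm{SOF}})\}\prec0 .$$
   Context: Notation: $\mathbb N$ is the set of nonnegative integers; $\lceil k\rceil_N$ denotes the remainder of $k$ divided by $N$; $\mathrm{He}\{X\}=X^T+X$; $\rho$ is the spectral radius; $\otimes$ is the Kronecker product; $\mathbf I_q$ is the $q\times q$ identity; $\mathbf 0$ is a zero matrix of appropriate size; $\mathbf e_{(q,i)}\in\mathbb R^q$ is the $i$-th standard unit column vector; $\mathbb S_+^n$ is the set of real symmetric positive definite $n\times n$ matrices; $\succ0$ ($\prec0$) means symmetric positive (negative) definite. $\mathcal L_q=[\mathbf I_q\ \ \mathbf 0_q]$ and $\mathcal R_q=[\mathbf 0_q\ \ \mathbf I_q]$, both in $\mathbb R^{q\times(q+1)}$, with $\mathbf 0_q$ the zero column vector (for $q=0$ these are empty and the corresponding blocks are absent). $\mathbf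 T_N\in\mathbb R^{N\times N}$ is the exchange matrix (ones on the anti-diagonal, zeros elsewhere). Any $\hat{\mathcal G}$ in a solution of the state-feedback LMI is invertible. Structured output-feedback (respectively state-feedback) gain matrix: a block lower triangular matrix collecting gains $F^{(k,i)}$, $0\le i\le k\le N-1$, of size $m\times p$ (respectively $m\times n$), $$\mathcal F=\begin{bmatrix}F^{(0,0)}&\mathbf 0&\cdots&\mathbf 0\\ F^{(1,1)}&F^{(1,0)}&\ddots&\vdots\\ \vdots&\ddots&\ddots&\mathbf 0\\ F^{(N-1,N-1)}&\cdots&F^{(N-1,1)}&F^{(N-1,0)}\end{bmatrix}.$$ The matrix $\hat{\mathcal F}_{\mathrm{SF}}$ is a structured state-feedback gain matrix. For a structured gain matrix $\mathcal F$, $\mathcal A_{\mathrm{LTI}}(\mathcal F,\Sigma)=\Phi_N\in\mathbb R^{n\times n}$, where $\Phi_0=\mathbf I_n$ and, for $\delta=1,\dots,N$, $\Phi_\delta=A\Phi_{\delta-1}+B\sum_{i=0}^{\delta-1}F^{(\delta-1,i)}C\,\Phi_{\delta-1-i}$ for an output-feedback gain matrix, and the same recursion with $C$ replaced by $\mathbf I_n$ for a state-feedback gain matrix. (It maps $x(k)$ to $x(k+N)$, for $k$ divisible by $N$, along the closed loop of $x(k+1)=Ax(k)+Bu(k)$, $y(k)=Cx(k)$ with $u(k)=\sum_{i=0}^{\lceil k\rceil_N}F^{(\lceil k\rceil_N,i)}y(k-i)$, respectively with $x(k-i)$ in place of $y(k-i)$.) For a matrix $X\in\mathbb R^{n\times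 n}$ with $\rho(X)<1$, $\mathcal P(X)=\{P\in\mathbb S_+^n: X^TPX-P\prec0\}$. $\mathcal L_{\mathrm{SOF}}^{(N)}(\Sigma)$ is the set of structured output-feedback gain matrices $\mathcal F\in\mathbb R^{Nm\times Np}$ with $\rho(\mathcal A_{\mathrm{LTI}}(\mathcal F,\Sigma))<1$, and $\mathcal S_{\mathrm{SOF}}^{(N)}(\Sigma)=\bigcup_{\mathcal F\in\mathcal L_{\mathrm{SOF}}^{(N)}(\Sigma)}\mathcal P(\mathcal A_{\mathrm{LTI}}(\mathcal F,\Sigma))$. Further matrices: $$\mathcal X_N(P,\gamma)=\bigl(-\gamma\,\mathbf e_{(N+1,1)}\mathbf e_{(N+1,1)}^T+\mathbf e_{(N+1,N+1)}\mathbf e_{(N+1,N+1)}^T\bigr)\otimes P,$$ $$\Pi_N=\begin{bmatrix}\mathbf e_{(N,1)}^T\otimes\mathbf I_n&\mathbf 0_{n\times Nm}\\ \mathbf I_N\otimes A&\mathbf I_N\otimes B\end{bmatrix},$$ $$\mathcal C(\mathcal F)=\begin{bmatrix}\mathcal F(\mathbf I_N\otimes C)&-\mathbf I_N\otimes\mathbf I_m\\ \mathcal L_{N-1}\otimes A-\mathcal R_{N-1}\otimes\mathbf I_n&\mathcal L_{N-1}\otimes B\end{bmatrix},$$ $$\mathcal H(\hat{\mathcal F}_{\mathrm{SF}})=\begin{bmatrix}\hat{\mathcal F}_{\mathrm{SF}}&-\mathbf I_N\otimes\mathbf I_m\\ \mathcal L_{N-1}\otimes A-\mathcal R_{N-1}\otimes\mathbf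 I_n&\mathcal L_{N-1}\otimes B\end{bmatrix}.$$ *)

(* Defs.v *)
From HB Require Import structures.
From mathcomp Require Import all_boot all_order all_algebra.
From mathcomp Require Import complex mxtens.
From mathcomp Require Import all_classical all_reals all_analysis.

Set Implicit Arguments.
Unset Strict Implicit.
Unset Printing Implicit Defensive.

Import Order.TTheory GRing.Theory Num.Theory.
Import numFieldNormedType.Exports.
Local Open Scope classical_set_scope.
Local Open Scope ring_scope.

(* The period is always written [N'.+1], so that it is positive and [N - 1] is
   [N'].  Time indices and block indices start at 0. *)

Section Matrices.
Context {R : realType}.

Definition He n (X : 'M[R]_n) : 'M[R]_n := X^T + X.

Definition posdef n (M : 'M[R]_n) : Prop :=
  M^T = M /\ forall v : 'cV[R]_n, v != 0 -> 0 < (v^T *m M *m v) ord0 ord0.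

Definition negdef n (M : 'M[R]_n) : Prop :=
  M^T = M /\ forall v : 'cV[R]_n, v != 0 -> (v^T *m M *m v) ord0 ord0 < 0.

(* The complex spectrum is finite, so for [0 < n] this supremum is a maximum. *)
Definition spectral_radius n (X : 'M[R]_n) : R :=
  sup [set ComplexField.Normc.normc l | l in
        [set l : complex R | eigenvalue (map_mx (real_complex R) X) l]].

Definition lmx q : 'M[R]_(q, q.+1) := castmx (erefl, addn1 q) (row_mx 1%:M 0).

(* [1 + q] is convertible to [q.+1]. *)
Definition rmx q : 'M[R]_(q, q.+1) := row_mx (0 : 'cV[R]_q) 1%:M.

Definition exchmx q : 'M[R]_q := \matrix_(i, j) (j == rev_ord i)%:R.

Definition unitcol q (i : 'I_q) : 'cV[R]_q := delta_mx i ord0.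

(* Block (i, j) of an M x N block matrix with r x s blocks; [mxtens_index] is
   also the indexing of the Kronecker product [*t]. *)
Definition blk M N r s (F : 'M[R]_(M * r, N * s)) (i : 'I_M) (j : 'I_N) :
    'M[R]_(r, s) :=
  \matrix_(a, b) F (mxtens_index (i, a)) (mxtens_index (j, b)).

Definition block_upper N r s (F : 'M[R]_(N * r, N * s)) : Prop :=
  forall i j : 'I_N, (j < i)%N -> blk F i j = 0.

Definition structured_gain N r s (F : 'M[R]_(N * r, N * s)) : Prop :=
  forall i j : 'I_N, (i < j)%N -> blk F i j = 0.

(* F^(k,i), meaningful for i <= k <= N': row block k, column block k - i. *)
Definition gain N' r s (F : 'M[R]_(N'.+1 * r, N'.+1 * s)) (k i : nat) :
    'M[R]_(r, s) :=
  blk F (inord k) (inord (k - i)).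

Section LTI.
Variables (N' n m p : nat) (A : 'M[R]_n) (B : 'M[R]_(n, m)) (C : 'M[R]_(p, n)).
Implicit Type F : 'M[R]_(N'.+1 * m, N'.+1 * p).

(* The list Phi_d, Phi_(d-1), ..., Phi_0, latest first. *)
Fixpoint Phi_hist F (d : nat) : seq 'M[R]_n :=
  if d is d'.+1 then
    let h := Phi_hist F d' in
    (A *m nth 0 h 0 +
     B *m \sum_(i < d'.+1) (gain F d' i *m C *m nth 0 h i)) :: h
  else [:: 1%:M].

Definition Phi F (d : nat) : 'M[R]_n := nth 0 (Phi_hist F d) 0.

Lemma nth_Phi_hist F d i : (i <= d)%N -> nth 0 (Phi_hist F d) i = Phi F (d - i).
Proof. by elim: d i => [|d IHd] [|i]; rewrite ?subn0 // subSS => /IHd. Qed.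

Lemma Phi0 F : Phi F 0 = 1%:M. Proof. by []. Qed.

Lemma PhiS F d :
  Phi F d.+1 = A *m Phi F d +
    B *m \sum_(i < d.+1) (gain F d i *m C *m Phi F (d - i)).
Proof.
rewrite /Phi /= -/(Phi F d); congr (_ + B *m _); apply: eq_bigr => i _.
by rewrite nth_Phi_hist // -ltnS.
Qed.

(* With [C := 1%:M] (so [p = n]) this is the state-feedback version. *)
Definition A_LTI F : 'M[R]_n := Phi F N'.+1.

Definition calP (X : 'M[R]_n) : set 'M[R]_n :=
  [set P | posdef P /\ negdef (X^T *m P *m X - P)].

Definition L_SOF : set 'M[R]_(N'.+1 * m, N'.+1 * p) :=
  [set F | structured_gain F /\ spectral_radius (A_LTI F) < 1].

Definition S_SOF : set 'M[R]_n := \bigcup_(F in L_SOF) calP (A_LTI F).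

(* As i <= k %% N <= k, the truncated subtraction [k - i] is exact. *)
Definition periodic_trajectories F : set (nat -> 'cV[R]_n) :=
  [set x | forall k : nat, x k.+1 = A *m x k +
     B *m \sum_(i < (k %% N'.+1).+1)
            (gain F (k %% N'.+1) i *m C *m x (k - i)%N)].

Definition LTI_trajectories (X : 'M[R]_n) : set (nat -> 'cV[R]_n) :=
  [set phi | forall t : nat, phi t.+1 = X *m phi t].

End LTI.

(* Lyapunov stability and attractivity of the origin, for a system given by its
   set of trajectories, each determined by its value at time 0. *)
Definition asymptotically_stable n (T : set (nat -> 'cV[R]_n)) : Prop :=
  (forall e : R, 0 < e -> exists2 d : R, 0 < d &
     forall x, T x -> `|x 0%N| < d -> forall k : nat, `|x k| < e) /\
  (exists2 c : R, 0 < c &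
     forall x, T x -> `|x 0%N| < c -> x @ \oo --> (0 : 'cV[R]_n)).

Definition calX N n (P : 'M[R]_n) (gamma : R) : 'M[R]_(N.+1 * n) :=
  (- gamma *: (unitcol ord0 *m (unitcol (ord0 : 'I_N.+1))^T)
   + unitcol ord_max *m (unitcol (ord_max : 'I_N.+1))^T) *t P.

(* The state-feedback LMI, including the structure of the unknowns. *)
Definition SF_LMI N n m (A : 'M[R]_n) (B : 'M[R]_(n, m))
    (P : 'M[R]_n) (J : 'M[R]_(N * m, N * n)) (G : 'M[R]_(N * n)) : Prop :=
  [/\ P^T = P, block_upper J, block_upper G &
   negdef (calX N P 1 + He (
     ((lmx N)^T *t A) *m G *m (rmx N *t (1%:M : 'M[R]_n))
     + ((lmx N)^T *t B) *m J *m (rmx N *t (1%:M : 'M[R]_n))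
     - ((rmx N)^T *t (1%:M : 'M[R]_n)) *m G *m (rmx N *t (1%:M : 'M[R]_n))))].

Definition F_SF N n m (J : 'M[R]_(N * m, N * n)) (G : 'M[R]_(N * n)) :
    'M[R]_(N * m, N * n) :=
  (exchmx N *t (1%:M : 'M[R]_m)) *m J *m invmx G *m (exchmx N *t (1%:M : 'M[R]_n)).

(* The block rows have [n] and [N * n] rows; [n + N * n] is convertible to
   [N.+1 * n], and the cast identifies [1 * n] with [n]. *)
Definition Pi_mx N' n m (A : 'M[R]_n) (B : 'M[R]_(n, m)) :
    'M[R]_(N'.+2 * n, N'.+1 * n + N'.+1 * m) :=
  block_mx
    (castmx (mul1n n, erefl) ((unitcol (ord0 : 'I_N'.+1))^T *t (1%:M : 'M[R]_n)))
    (0 : 'M[R]_(n, N'.+1 * m))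
    ((1%:M : 'M[R]_N'.+1) *t A) ((1%:M : 'M[R]_N'.+1) *t B).

Definition calH N' n m (A : 'M[R]_n) (B : 'M[R]_(n, m))
    (F : 'M[R]_(N'.+1 * m, N'.+1 * n)) :
    'M[R]_(N'.+1 * m + N' * n, N'.+1 * n + N'.+1 * m) :=
  block_mx
    F (- ((1%:M : 'M[R]_N'.+1) *t (1%:M : 'M[R]_m)))
    (lmx N' *t A - rmx N' *t (1%:M : 'M[R]_n)) (lmx N' *t B).

Definition calC N' n m p (A : 'M[R]_n) (B : 'M[R]_(n, m)) (C : 'M[R]_(p, n))
    (F : 'M[R]_(N'.+1 * m, N'.+1 * p)) :
    'M[R]_(N'.+1 * m + N' * n, N'.+1 * n + N'.+1 * m) :=
  block_mx
    (F *m ((1%:M : 'M[R]_N'.+1) *t C)) (- ((1%:M : 'M[R]_N'.+1) *t (1%:M : 'M[R]_m)))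
    (lmx N' *t A - rmx N' *t (1%:M : 'M[R]_n)) (lmx N' *t B).

End Matrices.

(* Main.v *)
Require Import Defs.
From HB Require Import structures.
From mathcomp Require Import all_boot all_order all_algebra.
From mathcomp Require Import complex mxtens.
From mathcomp Require Import all_classical all_reals all_analysis.
From mathcomp Require Import ring lra.

Set Implicit Arguments.
Unset Strict Implicit.
Unset Printing Implicit Defensive.

Import Order.TTheory GRing.Theory Num.Theory.
Import numFieldNormedType.Exports.
Local Open Scope classical_set_scope.
Local Open Scope ring_scope.

(** The vector [w = (x_0, ..., x_(N-1), u_0, ..., u_(N-1))] collects the states
    and inputs over one period. The quadratic form of the first term of the
    matrix inequality is [x_N^T P x_N - x_0^T P x_0] at [w], where
    [x_N = A x_(N-1) + B u_(N-1)]. For a structured gain [F], the kernel of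
    [calC A B C F] consists of the closed-loop trajectories over one period:
    each is determined by [x_0], with [x_k = Phi k x_0], so on it the form is
    that of [X^T P X - P] with [X = A_LTI A B C F]. The same holds for
    [calH A B F], which is [calC A B 1%:M F], and [F_SF J G] is structured
    because products and inverses of block upper triangular matrices are block
    upper triangular and conjugation by the exchange matrix reverses the order
    of the blocks.

    If the matrix inequality holds, restricting it to the kernel of [calC]
    kills the multiplier term and leaves the Lyapunov inequality
    [X^T P X - P < 0] with [P > 0], hence asymptotic stability of the sampled
    system ([LMI_lyapunov], [lyapunov_stable]).

    Conversely, [hb] provides one [P] which is a Lyapunov matrix both
    for the state-feedback closed loop and for some output-feedback closed
    loop. Thus the form is negative on the kernels of both [calH] and [calC],
    and [projection_lemma] produces the multiplier [V].

    Finally, a trajectory of the periodic system and its samples at multiples of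
    the period determine each other through the finitely many matrices [Phi d],
    [d <= N], so the two notions of asymptotic stability agree
    ([periodic_stable_LTI]). *)

(** * Quadratic forms *)

Section BilinearForms.
Variable R : realType.

Definition bform m n (M : 'M[R]_(m, n)) (u : 'cV[R]_m) (v : 'cV[R]_n) : R :=
  (u^T *m M *m v) ord0 ord0.

Lemma bformDl m n (M : 'M[R]_(m, n)) u1 u2 v :
  bform M (u1 + u2) v = bform M u1 v + bform M u2 v.
Proof. by rewrite /bform raddfD /= !mulmxDl mxE. Qed.

Lemma bformDr m n (M : 'M[R]_(m, n)) u v1 v2 :
  bform M u (v1 + v2) = bform M u v1 + bform M u v2.
Proof. by rewrite /bform mulmxDr mxE. Qed.

Lemma bformNl m n (M : 'M[R]_(m, n)) u v : bform M (- u) v = - bform M u v.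
Proof. by rewrite /bform raddfN /= !mulNmx mxE. Qed.

Lemma bformNr m n (M : 'M[R]_(m, n)) u v : bform M u (- v) = - bform M u v.
Proof. by rewrite /bform mulmxN mxE. Qed.

Lemma bformZl m n (M : 'M[R]_(m, n)) a u v :
  bform M (a *: u) v = a * bform M u v.
Proof. by rewrite /bform linearZ /= -!scalemxAl mxE. Qed.

Lemma bformZr m n (M : 'M[R]_(m, n)) a u v :
  bform M u (a *: v) = a * bform M u v.
Proof. by rewrite /bform -scalemxAr mxE. Qed.

Lemma bform0l m n (M : 'M[R]_(m, n)) v : bform M 0 v = 0.
Proof. by rewrite /bform trmx0 !mul0mx mxE. Qed.

Lemma bform0r m n (M : 'M[R]_(m, n)) u : bform M u 0 = 0.
Proof. by rewrite /bform mulmx0 mxE. Qed.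

Lemma bformD m n (M1 M2 : 'M[R]_(m, n)) u v :
  bform (M1 + M2) u v = bform M1 u v + bform M2 u v.
Proof. by rewrite /bform mulmxDr mulmxDl mxE. Qed.

Lemma bformN m n (M : 'M[R]_(m, n)) u v : bform (- M) u v = - bform M u v.
Proof. by rewrite /bform mulmxN mulNmx mxE. Qed.

Lemma bformZ m n (M : 'M[R]_(m, n)) a u v :
  bform (a *: M) u v = a * bform M u v.
Proof. by rewrite /bform -scalemxAr -scalemxAl mxE. Qed.

Lemma bform_tr m n (M : 'M[R]_(m, n)) u v : bform M^T v u = bform M u v.
Proof.
rewrite /bform -[RHS](_ : (u^T *m M *m v)^T ord0 ord0 = _); last by rewrite mxE.
by rewrite !trmx_mul trmxK mulmxA.
Qed.

Lemma bformC n (M : 'M[R]_n) u v : M^T = M -> bform M u v = bform M v u.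
Proof. by move=> MT; rewrite -bform_tr MT. Qed.

Lemma bform_congr m n p q (X : 'M[R]_(m, p)) (M : 'M[R]_(m, n))
    (Y : 'M[R]_(n, q)) u v :
  bform (X^T *m M *m Y) u v = bform M (X *m u) (Y *m v).
Proof. by rewrite /bform trmx_mul !mulmxA. Qed.

Lemma bform_mulr m n q (M : 'M[R]_(m, n)) (Y : 'M[R]_(n, q)) u v :
  bform (M *m Y) u v = bform M u (Y *m v).
Proof. by rewrite /bform !mulmxA. Qed.

Lemma bform_He n (X : 'M[R]_n) v : bform (He X) v v = 2 * bform X v v.
Proof. by rewrite bformD bform_tr mulr2n mulrDl mul1r. Qed.

Lemma bform1E n (v : 'cV[R]_n) : bform 1%:M v v = \sum_i v i ord0 ^+ 2.
Proof. by rewrite /bform mulmx1 mxE; apply: eq_bigr => i _; rewrite mxE. Qed.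

Lemma bform1_ge0 n (v : 'cV[R]_n) : 0 <= bform 1%:M v v.
Proof. by rewrite bform1E; apply: sumr_ge0 => i _; rewrite sqr_ge0. Qed.

Lemma bform1_gt0 n (v : 'cV[R]_n) : v != 0 -> 0 < bform 1%:M v v.
Proof.
move=> v0; rewrite lt_neqAle bform1_ge0 andbT eq_sym bform1E.
apply: contra v0 => /eqP /psumr_eq0P h; apply/eqP/matrixP => i j.
rewrite ord1 mxE; apply/eqP; rewrite -sqrf_eq0 h // => k _.
exact: sqr_ge0.
Qed.

Lemma He_sym n (X : 'M[R]_n) : (He X)^T = He X.
Proof. by rewrite /He raddfD /= trmxK addrC. Qed.

Lemma posdef_unit n (M : 'M[R]_n) : posdef M -> M \in unitmx.
Proof.
case=> MT Mpos; rewrite -unitmx_tr -row_free_unit -kermx_eq0.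
apply: contraT => /rowV0Pn [u /sub_kermxP uM u0].
have u0' : u^T != 0 by apply: contra u0 => /eqP h; rewrite -[u]trmxK h trmx0.
by have := Mpos _ u0'; rewrite trmxK -MT uM mul0mx mxE ltxx.
Qed.

Lemma bform_le n (M : 'M[R]_n) :
  exists2 k : R, 0 < k & forall v, bform M v v <= k * bform 1%:M v v.
Proof.
exists (1 + \sum_i \sum_j `|M i j|).
  by apply: ltr_pwDl => //; apply: sumr_ge0 => i _; apply: sumr_ge0 => j _.
move=> v; set s := bform 1%:M v v.
have s0 : 0 <= s by exact: bform1_ge0.
have sle i : v i ord0 ^+ 2 <= s.
  rewrite /s bform1E (bigD1 i) //= lerDl.
  by apply: sumr_ge0 => j _; exact: sqr_ge0.
rewrite mulrDl mul1r; apply: le_trans (_ : (\sum_i \sum_j `|M i j|) * s <= _);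
  last by rewrite lerDr.
have -> : bform M v v = \sum_j \sum_i v i ord0 * M i j * v j ord0.
  rewrite /bform mxE; apply: eq_bigr => j _; rewrite mxE mulr_suml.
  by apply: eq_bigr => i _; rewrite mxE.
rewrite exchange_big mulr_suml; apply: ler_sum => i _.
rewrite mulr_suml; apply: ler_sum => j _.
apply: le_trans (ler_norm _) _; rewrite !normrM mulrAC mulrC.
apply: ler_wpM2l => //; rewrite -normrM.
have := sle i; have := sle j; move: (v i ord0) (v j ord0) => a b ha hb.
rewrite ler_norml; have := sqr_ge0 (a + b); have := sqr_ge0 (a - b).
rewrite !sqrrD sqrrN; move: ha hb; rewrite !expr2 => *; apply/andP; split; lra.
Qed.

(** The form is nonnegative at [v - M^-1 v / k], where [k] bounds the form of
    [M^-1]; expanding gives [M(v) >= |v|^2 / k]. *)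
Lemma posdef_ge n (M : 'M[R]_n) : posdef M ->
  exists2 e : R, 0 < e & forall v, e * bform 1%:M v v <= bform M v v.
Proof.
move=> Mpos; have Mu := posdef_unit Mpos; case: (Mpos) => MT Mgt.
have Mge v : 0 <= bform M v v.
  by have [->|/Mgt/ltW//] := eqVneq v 0; rewrite bform0l.
have [k k0 hk] := bform_le (invmx M).
exists k^-1; first by rewrite invr_gt0.
move=> v; pose w := invmx M *m v.
have := Mge (v - k^-1 *: w).
rewrite !(bformDl, bformDr, bformNl, bformNr, bformZl, bformZr).
rewrite (bformC w v MT).
have -> : bform M v w = bform 1%:M v v.
  by rewrite /bform /w -mulmxA mulKVmx // mulmx1.
have -> : bform M w w = bform (invmx M) v v.
  rewrite (_ : bform M w w = bform 1%:M w v); last first.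
    by rewrite /bform {2}/w -mulmxA mulKVmx // mulmx1.
  by rewrite /bform /w trmx_mul trmx_inv MT mulmx1.
have /(ler_wpM2l (ltW (_ : 0 < k^-1 * k^-1))) := hk v.
rewrite mulr_gt0 ?invr_gt0 // => /(_ isT).
rewrite -[X in _ <= X]mulrA mulKf ?gt_eqF // => h1 h2; lra.
Qed.

(** As [pinvmx A] is a generalised inverse of [A], this is a projector onto the
    space of column vectors [v] with [A *m v = 0]. *)
Definition kproj m n (A : 'M[R]_(m, n)) : 'M[R]_n := 1%:M - pinvmx A *m A.

Lemma mul_pinvmxK m n (A : 'M[R]_(m, n)) : A *m pinvmx A *m A = A.
Proof. exact: mulmxKpV. Qed.

Lemma mul_kproj m n (A : 'M[R]_(m, n)) : A *m kproj A = 0.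
Proof. by rewrite mulmxBr mulmx1 mulmxA mul_pinvmxK subrr. Qed.

Lemma kproj_id m n (A : 'M[R]_(m, n)) (v : 'cV[R]_n) :
  A *m v = 0 -> kproj A *m v = v.
Proof. by move=> Av; rewrite mulmxBl mul1mx -mulmxA Av mulmx0 subr0. Qed.

(** A linear section: from [H *m u], with [u] fixed by [J], it recovers some
    vector in the range of [J] that has the same image. *)
Lemma pinvmx_lift a k (H : 'M[R]_(a, k)) (J : 'M[R]_k) (u : 'cV[R]_k) :
  J *m u = u -> H *m (J *m pinvmx (H *m J) *m (H *m u)) = H *m u.
Proof.
move=> Ju; have HJu : H *m u = H *m J *m u by rewrite -mulmxA Ju.
by rewrite HJu -[RHS](congr1 (mulmx^~ u) (mul_pinvmxK (H *m J))) !mulmxA.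
Qed.

(** Split [v = J v + D s] with [s = Z v] and [J v] in the kernel of [Z]. The
    matrix [E] is positive definite and extends [- Q] from that kernel, so
    completing the square with respect to [E] removes the cross term and leaves
    a form in [s] alone, which a multiple of [|s|^2] dominates. *)
Lemma finsler m n (Q : 'M[R]_n) (Z : 'M[R]_(m, n)) : Q^T = Q ->
  (forall v, v != 0 -> Z *m v = 0 -> bform Q v v < 0) ->
  exists mu : R, forall v, v != 0 ->
    bform Q v v - mu * bform 1%:M (Z *m v) (Z *m v) < 0.
Proof.
move=> QT Qneg; pose D := pinvmx Z; pose J := kproj Z.
pose E := (D *m Z)^T *m 1%:M *m (D *m Z) - J^T *m Q *m J.
have EE u v : bform E u v =
    bform 1%:M (D *m Z *m u) (D *m Z *m v) - bform Q (J *m u) (J *m v).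
  by rewrite bformD bformN !bform_congr.
have Edec (v : 'cV_n) : v = J *m v + D *m Z *m v.
  by rewrite mulmxBl mul1mx subrK.
have ET : E^T = E.
  rewrite /E; move: (D *m Z) (J) => W J1.
  by rewrite linearB /= !trmx_mul !trmxK QT trmx1 !mulmxA.
have Epos : posdef E.
  split=> // v v0; rewrite -/(bform E v v) EE.
  have [Jv|Jv] := eqVneq (J *m v) 0.
    have := v0; rewrite {1}(Edec v) Jv add0r => /bform1_gt0.
    by rewrite bform0l subr0.
  rewrite ltr_wpDl ?bform1_ge0 // oppr_gt0 Qneg //.
  by rewrite mulmxA mul_kproj mul0mx.
(* [G s] represents [bform Q _ (D s)] with respect to [E]. *)
pose G := invmx E *m Q *m D.
have EG u s : bform E u (G *m s) = bform Q u (D *m s).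
  by rewrite /bform /G -!mulmxA mulKVmx ?posdef_unit.
have [k k0 hk] := bform_le (G^T *m E *m G + D^T *m Q *m D).
exists (k + 1) => v v0; pose s := Z *m v; pose v0' := J *m v.
have Zv0 : Z *m v0' = 0 by rewrite mulmxA mul_kproj mul0mx.
have Ev0 : bform E v0' v0' = - bform Q v0' v0'.
  by rewrite EE -!mulmxA Zv0 !mulmx0 bform0l sub0r /J kproj_id.
have vE : v = v0' + D *m s by rewrite /s mulmxA -Edec.
have -> : bform Q v v = bform (G^T *m E *m G + D^T *m Q *m D) s s
                        - bform E (v0' - G *m s) (v0' - G *m s).
  rewrite bformD !bform_congr {1 2}vE.
  rewrite !(bformDl, bformDr, bformNl, bformNr).
  rewrite (bformC (D *m s) _ QT) (bformC (G *m s) v0' ET) Ev0 EG; ring.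
rewrite -/s; have := hk s => hks.
have s1 := bform1_ge0 s.
have [s0|/bform1_gt0 s0] := eqVneq s 0.
  have v0E : v = v0' by rewrite vE s0 mulmx0 addr0.
  rewrite s0 mulmx0 subr0 !bform0l mulr0 subr0 add0r oppr_lt0.
  by rewrite -v0E; case: Epos => _; apply.
have : 0 <= bform E (v0' - G *m s) (v0' - G *m s).
  have [->|] := eqVneq (v0' - G *m s) 0; first by rewrite bform0l.
  by case: Epos => _ h /h /ltW.
move=> h; lra.
Qed.

(** Definiteness of [Q] on the range of [K] makes the Gram matrix [K^T Q K] as
    injective as [K], so a generalised inverse of it yields the [Q]-orthogonal
    projection along that range, although [Q] is indefinite elsewhere. *)
Lemma orthogonal_projector k (Q K : 'M[R]_k) : Q^T = Q ->
  (forall x : 'cV[R]_k, K *m x != 0 -> bform Q (K *m x) (K *m x) < 0) ->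
  exists Pi : 'M[R]_k,
    [/\ forall x : 'cV[R]_k, Pi *m (K *m x) = 0,
        forall x v : 'cV[R]_k, bform Q (K *m x) (Pi *m v) = 0 &
        forall v : 'cV[R]_k, exists x : 'cV[R]_k, v - Pi *m v = K *m x].
Proof.
move=> QT QK; have [M ME] : exists M, M = K^T *m Q *m K by eexists.
have MT : M^T = M by rewrite ME !trmx_mul trmxK QT mulmxA.
have KM (y : 'cV_k) : M *m y = 0 -> K *m y = 0.
  move=> My; apply/eqP/contraT => /QK.
  by rewrite -bform_congr -ME /bform -mulmxA My mulmx0 mxE ltxx.
have [L LE] : exists L, M *m L *m M = M.
  by exists (pinvmx M); exact: mul_pinvmxK.
have LTE : M *m L^T *m M = M.
  by apply: trmx_inj; rewrite !trmx_mul trmxK MT mulmxA.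
have KE : K = K *m L *m M.
  apply/eqP; rewrite -subr_eq0; apply/eqP/matrixP => i j.
  have : K *m ((1%:M - L *m M) *m delta_mx j ord0) = 0 :> 'cV_k.
    by apply: KM; rewrite mulmxA mulmxBr mulmx1 mulmxA LE subrr mul0mx.
  rewrite mulmxA -colE mulmxBr mulmx1 mulmxA.
  by move=> /matrixP /(_ i ord0); rewrite !mxE.
exists (1%:M - K *m L^T *m K^T *m Q); split=> [x|x v|v].
- rewrite mulmxBl mul1mx.
  have -> : K *m L^T *m K^T *m Q *m (K *m x) = K *m (L^T *m M *m x).
    by rewrite ME !mulmxA.
  by rewrite -mulmxBr; apply: KM; rewrite mulmxBr !mulmxA LTE subrr.
- have KTM : K^T = M *m L^T *m K^T by rewrite {1}KE !trmx_mul MT mulmxA.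
  rewrite -bform_mulr /bform trmx_mul !mulmxBr mulmx1 !mulmxA.
  suff -> : x^T *m K^T *m Q *m K *m L^T *m K^T *m Q = x^T *m K^T *m Q.
    by rewrite subrr mul0mx mxE.
  by rewrite {3}KTM ME !mulmxA.
exists (L^T *m (K^T *m (Q *m v))).
by rewrite mulmxBl mul1mx subKr !mulmxA.
Qed.

(** Write a vector of ker C + ker H as [u + v] with [u] in ker C and [v] in
    ker H; moving the overlap into [u], [v] may be taken [Q]-orthogonal to the
    intersection of the two kernels. Then the cross term [bform Q u v] depends on [u] only through [H u] and on [v] only
    through [C v], so some [V] makes the added form cancel it, leaving
    [bform Q u u + bform Q v v]. *)
Lemma negdef_on_sum k a b (Q : 'M[R]_k) (H : 'M[R]_(a, k)) (C : 'M[R]_(b, k)) :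
  Q^T = Q ->
  (forall v, v != 0 -> H *m v = 0 -> bform Q v v < 0) ->
  (forall v, v != 0 -> C *m v = 0 -> bform Q v v < 0) ->
  exists V : 'M[R]_(a, b), forall u v, C *m u = 0 -> H *m v = 0 -> u + v != 0 ->
    bform (Q + He (H^T *m V *m C)) (u + v) (u + v) < 0.
Proof.
move=> QT QH QC.
have Qle v : (H *m v = 0 \/ C *m v = 0) -> bform Q v v <= 0.
  have [->|v0] := eqVneq v 0; first by rewrite bform0l.
  by case=> [/(QH _ v0)|/(QC _ v0)] /ltW.
pose K := kproj (col_mx H C).
have HK : H *m K = 0 /\ C *m K = 0.
  by apply/eq_col_mx; rewrite col_mx0 -mul_col_mx mul_kproj.
case: HK => HK CK.
have Kid (v : 'cV_k) : H *m v = 0 -> C *m v = 0 -> K *m v = v.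
  by move=> Hv Cv; apply: kproj_id; rewrite mul_col_mx Hv Cv col_mx0.
have KQ x : K *m x != 0 -> bform Q (K *m x) (K *m x) < 0.
  by move=> Kx; apply: QH => //; rewrite mulmxA HK mul0mx.
have [Pi [PiK Porth Pirange]] := orthogonal_projector QT KQ.
pose JH := kproj H; pose JC := kproj C.
(* [SH] and [SC] recover [u] from [H u], up to the intersection of the kernels,
   and [v] from [C v]. *)
pose SH := JC *m pinvmx (H *m JC); pose SC := Pi *m JH *m pinvmx (C *m JH).
exists (- (SH^T *m Q *m SC)) => u v Cu Hv.
wlog vP : u v Cu Hv / Pi *m v = v.
  have [x xE] := Pirange v.
  move=> wl; have -> : u + v = (u + K *m x) + Pi *m v.
    by rewrite -addrA -xE subrK.
  apply: wl.
  - by rewrite mulmxDr Cu add0r mulmxA CK mul0mx.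
  - by rewrite -[Pi *m v](subKr v) xE mulmxBr Hv mulmxA HK mul0mx subr0.
  - by rewrite -{1}[Pi *m v](subKr v) xE mulmxBr PiK subr0.
move=> uv0; rewrite bformD bform_He bform_congr bformN bform_congr.
have -> : H *m (u + v) = H *m u by rewrite mulmxDr Hv addr0.
have -> : C *m (u + v) = C *m v by rewrite mulmxDr Cu add0r.
have Hu : H *m (SH *m (H *m u)) = H *m u by apply: pinvmx_lift; exact: kproj_id.
have [x ux] : exists x, SH *m (H *m u) = u + K *m x.
  exists (SH *m (H *m u) - u); rewrite Kid; first by rewrite addrC subrK.
    by rewrite mulmxBr Hu subrr.
  by rewrite mulmxBr Cu subr0 !mulmxA mul_kproj !mul0mx.
have -> : SC *m (C *m v) = v.
  pose v' := JH *m pinvmx (C *m JH) *m (C *m v).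
  have Cv' : C *m v' = C *m v by apply: pinvmx_lift; exact: kproj_id.
  have -> : SC *m (C *m v) = Pi *m v' by rewrite /SC /v' !mulmxA.
  have -> : v' = v + K *m (v' - v).
    rewrite Kid; first by rewrite addrC subrK.
      by rewrite mulmxBr Hv subr0 /v' !mulmxA mul_kproj !mul0mx.
    by rewrite mulmxBr Cv' subrr.
  by rewrite (mulmxDr Pi) vP PiK addr0.
have -> : bform Q (SH *m (H *m u)) v = bform Q u v.
  by rewrite ux bformDl -[in X in _ + X]vP Porth addr0.
rewrite !(bformDl, bformDr) (bformC v u QT).
have -> : bform Q u u + bform Q u v + (bform Q u v + bform Q v v)
    + 2 * - bform Q u v = bform Q u u + bform Q v v by ring.
have := Qle u (or_intror Cu); have := Qle v (or_introl Hv).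
have [u0|u0] := eqVneq u 0; last by have := QC u u0 Cu => h1 h2 h3; lra.
have v0 : v != 0 by move: uv0; rewrite u0 add0r.
by have := QH v v0 Hv => h1 h2 h3; lra.
Qed.

(** Once the form is negative on ker C + ker H, the remaining
    directions are dealt with by Finsler's lemma: a matrix [Z] whose kernel is
    exactly that sum has its rows in both row spaces, [Z = S1 H = S2 C], so
    that the penalty [Z^T Z] is itself of the form [H^T V C]. *)
Theorem projection_lemma k a b
    (Q : 'M[R]_k) (H : 'M[R]_(a, k)) (C : 'M[R]_(b, k)) :
  Q^T = Q ->
  (forall v, v != 0 -> H *m v = 0 -> bform Q v v < 0) ->
  (forall v, v != 0 -> C *m v = 0 -> bform Q v v < 0) ->
  exists V : 'M[R]_(a, b), negdef (Q + He (H^T *m V *m C)).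
Proof.
move=> QT QH QC; have [V1 hV1] := negdef_on_sum QT QH QC.
set Q1 := Q + _ in hV1.
have Q1T : Q1^T = Q1 by rewrite /Q1 linearD /= QT He_sym.
pose JC := kproj C.
pose S1 := 1%:M - (H *m JC) *m pinvmx (H *m JC); pose Z := S1 *m H.
have ZJ : Z *m JC = 0.
  by rewrite /Z -mulmxA mulmxBl mul1mx mul_pinvmxK subrr.
have ZC : Z = Z *m pinvmx C *m C.
  by apply/eqP; rewrite -subr_eq0 -mulmxA -{1}(mulmx1 Z) -mulmxBr; apply/eqP.
have Zker w : Z *m w = 0 -> exists u v, [/\ C *m u = 0, H *m v = 0 & w = u + v].
  move=> Zw; pose u := JC *m (pinvmx (H *m JC) *m (H *m w)).
  exists u, (w - u); split; last by rewrite addrC subrK.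
    by rewrite mulmxA mul_kproj mul0mx.
  by rewrite mulmxBr -[RHS]Zw /Z /S1 !mulmxBl mul1mx /u !mulmxA.
have Q1Z w : w != 0 -> Z *m w = 0 -> bform Q1 w w < 0.
  by move=> w0 /Zker [u [v [Cu Hv wE]]]; rewrite wE in w0 *; exact: hV1.
have [mu hmu] := finsler Q1T Q1Z.
exists (V1 + (- (mu / 2)) *: (S1^T *m (Z *m pinvmx C))); split.
  by rewrite linearD /= QT He_sym.
move=> w /hmu; rewrite -/(bform _ _ _) /Q1 !(bformD Q) !bform_He.
rewrite !bform_congr bformD bformZ.
have -> : bform (S1^T *m (Z *m pinvmx C)) (H *m w) (C *m w)
    = bform 1%:M (Z *m w) (Z *m w).
  rewrite -[S1^T]mulmx1 bform_congr.
  by congr bform; rewrite mulmxA // -ZC.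
move=> h; lra.
Qed.
End BilinearForms.

(** * Block matrices and Kronecker products *)

Section Blocks.
Variable R : realType.

Lemma sum_mxtens (V : nmodType) N s (f : 'I_(N * s) -> V) :
  \sum_k f k = \sum_i \sum_a f (mxtens_index (i, a)).
Proof.
rewrite pair_big (reindex (@mxtens_unindex N s)) /=.
  by apply: eq_bigr => k _; rewrite -[in LHS](mxtens_unindexK k).
by exists (@mxtens_index N s) => k _; rewrite ?mxtens_indexK ?mxtens_unindexK.
Qed.

Lemma blk_inj M N r s (F G : 'M[R]_(M * r, N * s)) :
  (forall i j, blk F i j = blk G i j) -> F = G.
Proof.
move=> FG; apply/matrixP => k l.
case: (mxtens_indexP k) => i a; case: (mxtens_indexP l) => j b.
by have /matrixP /(_ a b) := FG i j; rewrite !mxE.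
Qed.

Lemma blk_tens M N r s (K : 'M[R]_(M, N)) (A : 'M[R]_(r, s)) i j :
  blk (K *t A) i j = K i j *: A.
Proof. by apply/matrixP => a b; rewrite mxE tensmxE mxE. Qed.

Lemma blk_mul M N L r s t
    (F : 'M[R]_(M * r, N * s)) (G : 'M[R]_(N * s, L * t)) i j :
  blk (F *m G) i j = \sum_k blk F i k *m blk G k j.
Proof.
apply/matrixP => a b; rewrite summxE !mxE sum_mxtens.
by apply: eq_bigr => k _; rewrite mxE; apply: eq_bigr => c _; rewrite !mxE.
Qed.

Lemma mxtens_unindexE N s (i : 'I_N) (a : 'I_s) :
  (mxtens_unindex (mxtens_index (i, a))).1 = i /\
  (mxtens_unindex (mxtens_index (i, a))).2 = a.
Proof. by rewrite mxtens_indexK. Qed.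

Definition vblk N s (v : 'cV[R]_(N * s)) (i : 'I_N) : 'cV[R]_s :=
  \col_a v (mxtens_index (i, a)) ord0.

Definition vstack N s (x : 'I_N -> 'cV[R]_s) : 'cV[R]_(N * s) :=
  \col_k x (mxtens_unindex k).1 (mxtens_unindex k).2 ord0.

Lemma vstackK N s (x : 'I_N -> 'cV[R]_s) i : vblk (vstack x) i = x i.
Proof.
apply/matrixP => a b; rewrite !mxE (ord1 b).
by have [-> ->] := mxtens_unindexE i a.
Qed.

Lemma vblk_inj N s (u v : 'cV[R]_(N * s)) :
  (forall i, vblk u i = vblk v i) -> u = v.
Proof.
move=> uv; apply/matrixP => k l; rewrite ord1.
case: (mxtens_indexP k) => i a.
by have /matrixP /(_ a ord0) := uv i; rewrite !mxE.
Qed.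

Lemma vblkD N s (u v : 'cV[R]_(N * s)) i : vblk (u + v) i = vblk u i + vblk v i.
Proof. by apply/matrixP => a b; rewrite !mxE. Qed.

Lemma vblkN N s (v : 'cV[R]_(N * s)) i : vblk (- v) i = - vblk v i.
Proof. by apply/matrixP => a b; rewrite !mxE. Qed.

Lemma vblk0 N s i : vblk (0 : 'cV[R]_(N * s)) i = 0.
Proof. by apply/matrixP => a b; rewrite !mxE. Qed.

Lemma vblk_mul M N r s (F : 'M[R]_(M * r, N * s)) v i :
  vblk (F *m v) i = \sum_j blk F i j *m vblk v j.
Proof.
apply/matrixP => a b; rewrite summxE !mxE sum_mxtens.
by apply: eq_bigr => k _; rewrite mxE; apply: eq_bigr => c _; rewrite !mxE.
Qed.

Lemma vblk_tens M N r s (K : 'M[R]_(M, N)) (A : 'M[R]_(r, s)) v i :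
  vblk ((K *t A) *m v) i = \sum_j K i j *: (A *m vblk v j).
Proof.
by rewrite vblk_mul; apply: eq_bigr => j _; rewrite blk_tens scalemxAl.
Qed.

Lemma vblk_tens1 N r s (A : 'M[R]_(r, s)) (v : 'cV[R]_(N * s)) i :
  vblk (((1%:M : 'M[R]_N) *t A) *m v) i = A *m vblk v i.
Proof.
rewrite vblk_tens (bigD1 i) //= big1 ?addr0 => [|j ji].
  by rewrite mxE eqxx scale1r.
by rewrite mxE eq_sym (negbTE ji) scale0r.
Qed.

Lemma vblk_col0 N s (a : 'cV[R]_s) (b : 'cV[R]_(N * s)) :
  vblk (col_mx a b : 'cV[R]_(N.+1 * s)) ord0 = a.
Proof.
apply/matrixP => i j; rewrite (ord1 j) mxE.
have -> : @mxtens_index N.+1 s (ord0, i) = lshift (N * s) i by exact: val_inj.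
exact: (col_mxEu a b).
Qed.

Lemma vblk_colS N s (a : 'cV[R]_s) (b : 'cV[R]_(N * s)) k :
  vblk (col_mx a b : 'cV[R]_(N.+1 * s)) (lift ord0 k) = vblk b k.
Proof.
apply/matrixP => i j; rewrite (ord1 j) mxE [RHS]mxE.
have -> : @mxtens_index N.+1 s (lift ord0 k, i) =
          rshift s (mxtens_index (k, i)).
  by apply: val_inj; rewrite /= /bump leq0n mulSn addnA.
exact: (col_mxEd a b).
Qed.

Lemma bform_tens M N r s (K : 'M[R]_(M, N)) (P : 'M[R]_(r, s)) y z :
  bform (K *t P) y z = \sum_i \sum_j K i j * bform P (vblk y i) (vblk z j).
Proof.
transitivity (\sum_i bform 1%:M (vblk y i) (vblk ((K *t P) *m z) i)).
  rewrite /bform -mulmxA mxE sum_mxtens; apply: eq_bigr => i _.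
  by rewrite mulmx1 mxE; apply: eq_bigr => a _; rewrite !mxE.
apply: eq_bigr => i _; rewrite vblk_tens /bform mulmx1 mulmx_sumr summxE.
by apply: eq_bigr => j _; rewrite -scalemxAr mxE mulmxA.
Qed.

Lemma bform_calX N n (P : 'M[R]_n) (y z : 'cV[R]_(N.+1 * n)) :
  bform (calX N P 1) y z = bform P (vblk y ord_max) (vblk z ord_max)
                         - bform P (vblk y ord0) (vblk z ord0).
Proof.
have sum_delta (k : 'I_N.+1) (f : 'I_N.+1 -> 'I_N.+1 -> R) :
    \sum_i \sum_j (unitcol k *m (unitcol k)^T : 'M[R]_N.+1) i j * f i j = f k k.
  rewrite trmx_delta mul_delta_mx (bigD1 k) //= [X in _ + X]big1 ?addr0.
    rewrite (bigD1 k) //= big1 ?addr0; first by rewrite mxE !eqxx mul1r.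
    by move=> j /negbTE jk; rewrite mxE jk andbF mul0r.
  by move=> i /negbTE ik; rewrite big1 // => j _; rewrite mxE ik mul0r.
pose f i j := bform P (vblk y i) (vblk z j).
rewrite bform_tens -[X in _ = X - _](sum_delta ord_max f).
rewrite -[X in _ = _ - X](sum_delta ord0 f) -sumrB; apply: eq_bigr => i _.
rewrite -sumrB; apply: eq_bigr => j _; rewrite mxE mulrDl addrC; congr (_ + _).
by rewrite mxE mulN1r mulNr.
Qed.

Lemma lmxE q (i : 'I_q) (j : 'I_q.+1) :
  (lmx q : 'M[R]_(q, q.+1)) i j = (j == widen_ord (leqnSn q) i)%:R.
Proof.
rewrite castmxE mxE; case: splitP => k /= jk.
  by rewrite mxE cast_ord_id -!val_eqE /= jk eq_sym.
rewrite mxE -val_eqE /= jk; case: eqP => // ik.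
by have := ltn_ord i; rewrite -ik ltnNge leq_addr.
Qed.

Lemma rmxE q (i : 'I_q) (j : 'I_q.+1) :
  (rmx q : 'M[R]_(q, q.+1)) i j = (j == lift ord0 i)%:R.
Proof.
rewrite (mxE _ _ i j); case: splitP => k /= jk.
  by rewrite mxE -val_eqE /= jk (ord1 k).
by rewrite mxE -!val_eqE /= jk /bump leq0n eqSS eq_sym.
Qed.

Lemma vblk_lmx q r s (A : 'M[R]_(r, s)) (v : 'cV[R]_(q.+1 * s)) i :
  vblk ((lmx q *t A) *m v) i = A *m vblk v (widen_ord (leqnSn q) i).
Proof.
rewrite vblk_tens (bigD1 (widen_ord (leqnSn q) i)) //= big1 ?addr0.
  by rewrite lmxE eqxx scale1r.
by move=> j /negbTE ji; rewrite lmxE ji scale0r.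
Qed.

Lemma vblk_rmx q r s (A : 'M[R]_(r, s)) (v : 'cV[R]_(q.+1 * s)) i :
  vblk ((rmx q *t A) *m v) i = A *m vblk v (lift ord0 i).
Proof.
rewrite vblk_tens (bigD1 (lift ord0 i)) //= big1 ?addr0.
  by rewrite rmxE eqxx scale1r.
by move=> j /negbTE ji; rewrite rmxE ji scale0r.
Qed.

Lemma block_upper_mul N r s t
    (F : 'M[R]_(N * r, N * s)) (G : 'M[R]_(N * s, N * t)) :
  block_upper F -> block_upper G -> block_upper (F *m G).
Proof.
move=> Fu Gu i j ji; rewrite blk_mul big1 // => k _.
have [ki|ik] := ltnP k i; first by rewrite Fu // mul0mx.
by rewrite (Gu k j) ?mulmx0 // (leq_trans ji ik).
Qed.

(** The rows with block index at least [i] span a subspace invariant under [G];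
    by injectivity it is mapped onto itself, hence is invariant under the
    inverse as well. A singular [G] is its own [invmx]. *)
Lemma block_upper_inv N s (G : 'M[R]_(N * s)) :
  block_upper G -> block_upper (invmx G).
Proof.
have [Gu|/negbTE Gn] := boolP (G \in unitmx); last by rewrite /invmx Gn.
move=> GU i j ji.
pose D : 'M[R]_(N * s) :=
  (\matrix_(a, b) ((i <= a)%N && (a == b))%:R : 'M[R]_N) *t (1%:M : 'M[R]_s).
have DM M a b : blk (D *m M) a b = (i <= a)%N%:R *: blk M a b.
  rewrite blk_mul (bigD1 a) //= big1 ?addr0.
    by rewrite blk_tens mxE eqxx andbT -scalemxAl mul1mx.
  by move=> c /negbTE ca; rewrite blk_tens mxE eq_sym ca andbF scale0r mul0mx.
have MD M a b : blk (M *m D) a b = (i <= b)%N%:R *: blk M a b.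
  rewrite blk_mul (bigD1 b) //= big1 ?addr0.
    by rewrite blk_tens mxE eqxx andbT -scalemxAr mulmx1.
  by move=> c /negbTE ca; rewrite blk_tens mxE ca andbF scale0r mulmx0.
have DGD : D *m G = D *m G *m D.
  apply: blk_inj => a b; rewrite MD DM.
  have [ib|bi] := leqP i b; first by rewrite scale1r.
  have [ia|ai] := leqP i a; last by rewrite !scale0r.
  by rewrite GU ?scaler0 // (leq_trans bi).
have DGle : (D *m G <= D)%MS by rewrite DGD submxMl.
have : (D <= D *m G)%MS.
  have [_] := mxrank_leqif_sup DGle.
  by rewrite mxrankMfree ?row_free_unit // eqxx.
move=> /(submxMr (invmx G)); rewrite mulmxK // => /submxP [Y YE].
have := DM _ _ (invmx G) i j; rewrite leqnn scale1r => <-.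
by rewrite YE MD leqNgt ji scale0r.
Qed.

Lemma F_SF_structured N n m (J : 'M[R]_(N * m, N * n)) (G : 'M[R]_(N * n)) :
  block_upper J -> block_upper G -> structured_gain (F_SF J G).
Proof.
move=> Ju Gu i j ij; rewrite /F_SF -(mulmxA _ J).
have := block_upper_mul Ju (block_upper_inv Gu).
move: (J *m invmx G) => K Ku.
rewrite blk_mul (bigD1 (rev_ord j)) //= [X in _ + X]big1 ?addr0.
  rewrite blk_mul (bigD1 (rev_ord i)) //= [X in (_ + X) *m _]big1 ?addr0.
    rewrite (Ku (rev_ord i) (rev_ord j)) ?mulmx0 ?mul0mx //=.
    exact: ltn_sub2l (leq_ltn_trans _ (ltn_ord j)) _.
  by move=> k /negbTE ki; rewrite blk_tens mxE ki scale0r mul0mx.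
move=> k kj; rewrite blk_tens mxE.
rewrite (_ : j == rev_ord k = false) ?scale0r ?mulmx0 //.
by apply/negbTE; apply: contra kj => /eqP ->; rewrite rev_ordK.
Qed.

Lemma tens11 M N : (1%:M : 'M[R]_M) *t (1%:M : 'M[R]_N) = 1%:M.
Proof.
apply: blk_inj => i j; rewrite blk_tens; apply/matrixP => a b.
rewrite !mxE -natrM mulnb; congr (nat_of_bool _)%:R.
by rewrite -xpair_eqE (can_eq (@mxtens_indexK M N)).
Qed.

End Blocks.

(** * Closed-loop trajectories over one period *)

Section ClosedLoop.
Variables (R : realType) (N' n m p : nat).
Variables (A : 'M[R]_n) (B : 'M[R]_(n, m)) (C : 'M[R]_(p, n)).
Variable F : 'M[R]_(N'.+1 * m, N'.+1 * p).
Hypothesis Fs : structured_gain F.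

(** The row [k] of a structured gain only sees the outputs up to time [k], which
    is where the truncation of the sum comes from. *)
Lemma sum_gain (g : nat -> 'cV[R]_n) (k : 'I_N'.+1) :
  \sum_j blk F k j *m C *m g j =
  \sum_(i < k.+1) gain F k i *m C *m g (k - i)%N.
Proof.
transitivity (\sum_(0 <= j < N'.+1) blk F k (inord j) *m C *m g j).
  by rewrite big_mkord; apply: eq_bigr => j _; rewrite inord_val.
rewrite (big_cat_nat (n := k.+1)) //= [X in _ + X]big_nat_cond [X in _ + X]big1.
  rewrite addr0 big_nat_rev big_mkord; apply: eq_bigr => i _.
  by rewrite /gain inord_val add0n subSS.
move=> j /andP [/andP [kj jN] _].
by rewrite Fs ?mul0mx // inordK.
Qed.

Lemma calC_ker (X : 'cV[R]_(N'.+1 * n)) (U : 'cV[R]_(N'.+1 * m)) :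
  calC A B C F *m col_mx X U = 0 <->
  (forall k : 'I_N'.+1, vblk U k = \sum_j blk F k j *m C *m vblk X j) /\
  (forall k : 'I_N', vblk X (lift ord0 k) =
     A *m vblk X (widen_ord (leqnSn N') k)
     + B *m vblk U (widen_ord (leqnSn N') k)).
Proof.
rewrite mul_block_col -col_mx0 tens11.
have E1 k : vblk (F *m (1%:M *t C) *m X + - 1%:M *m U) k =
   \sum_j blk F k j *m C *m vblk X j - vblk U k.
  rewrite vblkD mulNmx mul1mx vblkN -mulmxA vblk_mul; congr (_ - _).
  by apply: eq_bigr => j _; rewrite vblk_tens1 mulmxA.
have E2 k : vblk ((lmx N' *t A - rmx N' *t 1%:M) *m X + lmx N' *t B *m U) k =
   A *m vblk X (widen_ord (leqnSn N') k) + B *m vblk U (widen_ord (leqnSn N') k)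
   - vblk X (lift ord0 k).
  rewrite vblkD mulmxBl vblkD vblkN !vblk_lmx vblk_rmx mul1mx.
  by rewrite addrAC.
split.
  move=> /eq_col_mx [h1 h2]; split=> k; apply/eqP; rewrite eq_sym -subr_eq0.
    by rewrite -E1 h1 vblk0.
  by rewrite -E2 h2 vblk0.
move=> [h1 h2]; congr col_mx; apply: vblk_inj => k; rewrite vblk0.
  by rewrite E1 h1 subrr.
by rewrite E2 h2 subrr.
Qed.

Lemma calC_kerP X U : calC A B C F *m col_mx X U = 0 ->
  forall k : 'I_N'.+1,
   vblk X k = Phi A B C F k *m vblk X ord0 /\
   A *m vblk X k + B *m vblk U k = Phi A B C F k.+1 *m vblk X ord0.
Proof.
move=> /calC_ker [h1 h2].
have step (k : 'I_N'.+1) :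
    (forall j : 'I_N'.+1, (j <= k)%N ->
       vblk X j = Phi A B C F j *m vblk X ord0) ->
    A *m vblk X k + B *m vblk U k = Phi A B C F k.+1 *m vblk X ord0.
  move=> hk; rewrite PhiS mulmxDl -mulmxA -hk // h1; congr (_ + _).
  under eq_bigr do rewrite -[X in vblk _ X]inord_val.
  rewrite (sum_gain (fun j => vblk X (inord j)) k) -mulmxA mulmx_suml.
  congr (B *m _).
  apply: eq_bigr => i _.
  have kiN : (k - i < N'.+1)%N by exact: leq_ltn_trans (leq_subr _ _) _.
  by rewrite -[RHS]mulmxA hk inordK // leq_subr.
suff main (d : nat) (k : 'I_N'.+1) :
    (k <= d)%N -> vblk X k = Phi A B C F k *m vblk X ord0.
  move=> k; split; first exact: (main k).
  by apply: step => j _; exact: (main j).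
elim: d k => [|d IHd] k.
  rewrite leqn0 => /eqP k0.
  by rewrite (_ : k = ord0) ?Phi0 ?mul1mx //; exact: val_inj.
case: (unliftP ord0 k) => [k'|] ->; last by rewrite Phi0 mul1mx.
rewrite lift0 ltnS => k'd; rewrite h2 step //.
by move=> j jk'; apply: IHd; apply: leq_trans k'd.
Qed.

Definition lifted_traj (v : 'cV[R]_n) : 'cV[R]_(N'.+1 * n + N'.+1 * m) :=
  col_mx (vstack (fun k : 'I_N'.+1 => Phi A B C F k *m v))
    (vstack (fun k : 'I_N'.+1 =>
      \sum_(i < k.+1) gain F k i *m C *m (Phi A B C F (k - i) *m v))).

Lemma calC_lifted_traj v : calC A B C F *m lifted_traj v = 0.
Proof.
apply/calC_ker; split=> k; rewrite !vstackK.
  rewrite -(sum_gain (fun j => Phi A B C F j *m v)).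
  by apply: eq_bigr => j _; rewrite vstackK.
rewrite lift0 PhiS mulmxDl -!mulmxA mulmx_suml; congr (_ + B *m _).
by apply: eq_bigr => i _; rewrite !mulmxA.
Qed.

Lemma bform_Pi (P : 'M[R]_n) (X : 'cV[R]_(N'.+1 * n)) (U : 'cV[R]_(N'.+1 * m)) :
  bform ((Pi_mx N' A B)^T *m calX N'.+1 P 1 *m Pi_mx N' A B)
    (col_mx X U) (col_mx X U) =
  let xN := A *m vblk X ord_max + B *m vblk U ord_max in
  bform P xN xN - bform P (vblk X ord0) (vblk X ord0).
Proof.
rewrite bform_congr bform_calX.
pose T := castmx (mul1n n, erefl (N'.+1 * n)%N)
  ((unitcol (ord0 : 'I_N'.+1))^T *t (1%:M : 'M[R]_n)).
have -> : Pi_mx N' A B *m col_mx X U =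
    col_mx (T *m X + 0 *m U) ((1%:M *t A) *m X + (1%:M *t B) *m U).
  exact: mul_block_col.
have TX : T *m X = vblk X ord0.
  pose Y := ((unitcol (ord0 : 'I_N'.+1))^T *t (1%:M : 'M[R]_n)) *m X.
  have -> : T *m X = castmx (mul1n n, erefl 1%N) Y.
    by rewrite castmx_mul castmx_id.
  transitivity (vblk Y ord0).
    apply/matrixP => i j; rewrite (ord1 j) castmxE [RHS]mxE.
    by congr (fun_of_matrix Y); apply: val_inj.
  rewrite vblk_tens (bigD1 ord0) //= big1 ?addr0 => [|j /negbTE j0].
    by rewrite !mxE !eqxx scale1r mul1mx.
  by rewrite !mxE j0 scale0r.
rewrite mul0mx addr0 TX.
have -> : (ord_max : 'I_N'.+2) = lift ord0 ord_max by apply: val_inj.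
by rewrite !vblk_colS !vblk_col0 vblkD !vblk_tens1.
Qed.

(** On the kernel the end state is [A_LTI A B C F *m x_0], so the form measures
    the variation of [P] over one step of the lifted system. *)
Lemma bform_Pi_ker (P : 'M[R]_n) w : calC A B C F *m w = 0 ->
  bform ((Pi_mx N' A B)^T *m calX N'.+1 P 1 *m Pi_mx N' A B) w w =
  bform ((A_LTI A B C F)^T *m P *m A_LTI A B C F - P)
    (vblk (usubmx w) ord0) (vblk (usubmx w) ord0).
Proof.
rewrite -[w]vsubmxK => /calC_kerP h; rewrite bform_Pi /= col_mxKu.
by have [_ ->] := h ord_max; rewrite bformD bformN bform_congr.
Qed.

Lemma calC_ker_eq0 w :
  calC A B C F *m w = 0 -> vblk (usubmx w) ord0 = 0 -> w = 0.
Proof.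
rewrite -[w]vsubmxK col_mxKu => h; have := h => /calC_ker [hU _].
move: h => /calC_kerP h w0; rewrite -col_mx0.
have X0 k : vblk (usubmx w) k = 0 by have [-> _] := h k; rewrite w0 mulmx0.
congr col_mx; apply: vblk_inj => k; rewrite vblk0 // hU big1 // => j _.
by rewrite X0 mulmx0.
Qed.

Lemma negdef_on_calC_ker (P : 'M[R]_n) :
  negdef ((A_LTI A B C F)^T *m P *m A_LTI A B C F - P) ->
  forall w, w != 0 -> calC A B C F *m w = 0 ->
   bform ((Pi_mx N' A B)^T *m calX N'.+1 P 1 *m Pi_mx N' A B) w w < 0.
Proof.
move=> [_ h] w w0 Cw; rewrite bform_Pi_ker //; apply: h.
by apply: contra w0 => /eqP /(calC_ker_eq0 Cw) ->.
Qed.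

(** Evaluated at a lifted trajectory, which [calC] annihilates, the multiplier
    term vanishes whatever [H] and [V] are. *)
Lemma LMI_lyapunov (P : 'M[R]_n) (H V : 'M[R]_(N'.+1 * m + N' * n, _)) :
  P^T = P ->
  negdef ((Pi_mx N' A B)^T *m calX N'.+1 P 1 *m Pi_mx N' A B
    + He (H^T *m V *m calC A B C F)) ->
  negdef ((A_LTI A B C F)^T *m P *m A_LTI A B C F - P).
Proof.
move=> PT [_ neg]; split; first by rewrite linearB /= !trmx_mul trmxK PT mulmxA.
move=> v v0; have Cw := calC_lifted_traj v.
have x0 : vblk (usubmx (lifted_traj v)) ord0 = v.
  by rewrite col_mxKu vstackK Phi0 mul1mx.
have := bform_Pi_ker P Cw; rewrite x0 -/(bform _ v v) => <-.
have := neg (lifted_traj v).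
rewrite -/(bform _ _ _) (bformD (_ *m _ *m _)) bform_He.
rewrite (bform_mulr (H^T *m V) (calC A B C F)) Cw bform0r mulr0 addr0; apply.
apply: contra v0 => /eqP w0; rewrite -x0 w0 (_ : usubmx 0 = 0) ?vblk0 //.
by apply/matrixP => i j; rewrite !mxE.
Qed.
End ClosedLoop.

Lemma calH_calC (R : realType) N' n m (A : 'M[R]_n) (B : 'M[R]_(n, m))
  (F : 'M[R]_(N'.+1 * m, N'.+1 * n)) : calH A B F = calC A B 1%:M F.
Proof. by rewrite /calH /calC !tens11 mulmx1. Qed.

(** * Stability *)

Section Stability.
Variable R : realType.

Lemma coord_le_norm n (v : 'cV[R]_n) i : `|v i ord0| <= `|v|.
Proof.
rewrite [`|v|]mx_normrE.
exact: (le_bigmax 0 (fun ij => `|v ij.1 ij.2|) (i, ord0)).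
Qed.

Lemma norm_le_coord n (v : 'cV[R]_n) c : 0 <= c ->
  (forall i, `|v i ord0| <= c) -> `|v| <= c.
Proof.
move=> c0 vc; rewrite [`|v|]mx_normrE.
by apply: bigmax_le => // -[i j] _; rewrite ord1.
Qed.

Lemma sqr_norm_le n (v : 'cV[R]_n) : `|v| ^+ 2 <= bform 1%:M v v.
Proof.
rewrite -(sqr_sqrtr (bform1_ge0 v)) lerXn2r ?nnegrE ?sqrtr_ge0 //.
apply: norm_le_coord; first exact: sqrtr_ge0.
move=> i; rewrite -sqrtr_sqr ler_wsqrtr // bform1E (bigD1 i) //= lerDl.
by apply: sumr_ge0 => j _; exact: sqr_ge0.
Qed.

Lemma bform1_le_norm n (v : 'cV[R]_n) : bform 1%:M v v <= n%:R * `|v| ^+ 2.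
Proof.
rewrite bform1E; apply: le_trans (_ : \sum_(i < n) `|v| ^+ 2 <= _).
  apply: ler_sum => i _; rewrite -real_normK ?num_real //.
  by rewrite lerXn2r ?nnegrE // coord_le_norm.
by rewrite sumr_const card_ord mulr_natl.
Qed.

Lemma mulmx_norm_le m n (M : 'M[R]_(m, n)) :
  exists2 k : R, 0 < k & forall v : 'cV[R]_n, `|M *m v| <= k * `|v|.
Proof.
exists (1 + \sum_i \sum_j `|M i j|).
  by apply: ltr_pwDl => //; apply: sumr_ge0 => i _; apply: sumr_ge0 => j _.
move=> v; apply: norm_le_coord.
  rewrite mulr_ge0 // addr_ge0 //.
  by apply: sumr_ge0 => i _; apply: sumr_ge0 => j _.
move=> i; rewrite mxE; apply: le_trans (ler_norm_sum _ _ _) _.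
apply: le_trans (_ : (\sum_j `|M i j|) * `|v| <= _).
  rewrite mulr_suml; apply: ler_sum => j _; rewrite normrM.
  by apply: ler_wpM2l => //; exact: coord_le_norm.
apply: ler_wpM2r => //; rewrite [X in 1 + X](bigD1 i) //= addrCA lerDl.
by rewrite addr_ge0 //; apply: sumr_ge0 => k _; apply: sumr_ge0 => j _.
Qed.

(** With [a |v|^2 <= P(v) - P(X v)] and [P(v) <= k |v|^2], each step multiplies
    the Lyapunov function [P(v)] by at most [k / (k + a) < 1]; positive
    definiteness turns this into geometric decay of the norm. *)
Theorem lyapunov_stable n (X P : 'M[R]_n) :
  posdef P -> negdef (X^T *m P *m X - P) ->
  asymptotically_stable (LTI_trajectories X).
Proof.
move=> Ppos [DT Dneg]; pose D := P - X^T *m P *m X.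
have Dpos : posdef D.
  rewrite /D -opprB; split; first by rewrite linearN /= DT.
  by move=> v /Dneg; rewrite mulmxN mulNmx [in X in _ -> X]mxE oppr_gt0.
have [a a0 ha] := posdef_ge Dpos; have [b b0 hb] := posdef_ge Ppos.
have [k k0 hk] := bform_le P.
pose r := k / (k + a).
have ka0 : 0 < k + a by exact: addr_gt0.
have r01 : 0 <= r < 1.
  by rewrite /r divr_ge0 ?(ltW k0) ?(ltW ka0) //= ltr_pdivrMr // mul1r ltrDl.
have step v : bform P (X *m v) (X *m v) <= r * bform P v v.
  rewrite /r mulrAC ler_pdivlMr //.
  have := ha v; rewrite bformD bformN bform_congr => hav.
  have hkv := hk v; have s0 := bform1_ge0 v.
  move: hav hkv s0; move: (bform P (X *m v) _) (bform P v v) (bform 1%:M v v).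
  move=> q p s h1 h2 h3.
  have h4 : a * q <= a * p.
    by rewrite ler_pM2l //; have := mulr_ge0 (ltW a0) h3; lra.
  have h5 := ler_wpM2l (ltW a0) h2; have h6 := ler_wpM2l (ltW k0) h1.
  have h7 : k * (a * s) = a * (k * s) by ring.
  rewrite mulrDr ![q * _]mulrC; lra.
(* [n + 1] instead of [n] keeps [c] positive in dimension 0. *)
pose c := b^-1 * (k * (n%:R + 1)).
have c0 : 0 < c by rewrite !mulr_gt0 ?invr_gt0 // ltr_wpDl ?ler0n.
have decay x : LTI_trajectories X x ->
    forall t, `|x t| ^+ 2 <= c * `|x 0%N| ^+ 2 * r ^+ t.
  move=> hx t.
  have Px : bform P (x t) (x t) <= r ^+ t * bform P (x 0%N) (x 0%N).
    elim: t => [|t IHt]; first by rewrite expr0 mul1r.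
    rewrite hx; apply: le_trans (step _) _; rewrite exprS -[leRHS]mulrA.
    by apply: ler_wpM2l => //; case/andP: r01.
  apply: le_trans (sqr_norm_le _) _.
  have h1 := hb (x t); have h2 := hk (x 0%N); have h3 := bform1_le_norm (x 0%N).
  have rt0 : 0 <= r ^+ t by rewrite exprn_ge0 //; case/andP: r01.
  have s0 : 0 <= `|x 0%N| ^+ 2 by exact: sqr_ge0.
  move: (`|x 0%N| ^+ 2) h3 s0 => s h3 s0.
  rewrite /c -!mulrA ler_pdivlMl //; apply: le_trans h1 _; apply: le_trans Px _.
  rewrite mulrC !mulrA; apply: ler_wpM2r => //; apply: le_trans h2 _.
  rewrite -mulrA; apply: ler_wpM2l; first exact: ltW.
  by apply: le_trans h3 _; rewrite mulrDl lerDl mul1r.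
split.
  move=> e e0; have ec0 : 0 < e / (c + 1) by rewrite divr_gt0 // addr_gt0.
  (* The factor [c + 1] works because [c < (c + 1) ^+ 2]. *)
  exists (e / (c + 1)) => //.
  move=> x hx xd t; rewrite -(ltr_pXn2r (n := 2)) ?nnegrE ?(ltW e0) //.
  apply: le_lt_trans (decay x hx t) _.
  apply: le_lt_trans (_ : c * `|x 0%N| ^+ 2 < _).
    case/andP: r01 => r0 /ltW r1; apply: ler_piMr; last exact: exprn_ile1.
    by rewrite mulr_ge0 ?sqr_ge0 // ltW.
  apply: le_lt_trans (_ : c * (e / (c + 1)) ^+ 2 < _).
    apply: ler_wpM2l; first exact: ltW.
    by rewrite lerXn2r ?nnegrE ?(ltW xd) ?(ltW ec0).
  rewrite expr_div_n mulrA ltr_pdivrMr ?exprn_gt0 ?addr_gt0 // mulrC.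
  rewrite ltr_pM2l ?exprn_gt0 // sqrrD mulr1 expr1n; have := sqr_ge0 c; lra.
exists 1 => // x hx _; apply/cvgr0Pnorm_lt => e e0.
have rlt : `|r| < 1 by rewrite ger0_norm; case/andP: r01.
have /cvgr0_norm_lt := cvg_geometric (c * `|x 0%N| ^+ 2) rlt.
move=> /(_ _ (exprn_gt0 2 e0)); apply: filterS => t ht.
rewrite -(ltr_pXn2r (n := 2)) ?nnegrE ?(ltW e0) //.
by apply: le_lt_trans (decay x hx t) _; apply: le_lt_trans (ler_norm _) ht.
Qed.

Section Periodic.
Variables (N' n m p : nat).
Variables (A : 'M[R]_n) (B : 'M[R]_(n, m)) (C : 'M[R]_(p, n)).
Variable F : 'M[R]_(N'.+1 * m, N'.+1 * p).
Let Phi := Phi A B C F.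

Lemma periodic_traj_Phi x : periodic_trajectories A B C F x ->
  forall t d, (d <= N'.+1)%N -> x (N'.+1 * t + d)%N = Phi d *m x (N'.+1 * t)%N.
Proof.
move=> hx t d; elim/ltn_ind: d => -[|d] IHd dN.
  by rewrite addn0 /Phi Phi0 mul1mx.
have dm : ((N'.+1 * t + d) %% N'.+1 = d)%N by rewrite mulnC modnMDl modn_small.
rewrite addnS hx dm IHd // 1?ltnW // /Phi PhiS mulmxDl -!mulmxA mulmx_suml.
congr (_ + B *m _); apply: eq_bigr => i _.
have id : (i <= d)%N by rewrite -ltnS.
rewrite -addnBA // IHd ?mulmxA //; first by rewrite ltnS leq_subr.
by rewrite (leq_trans (leq_subr _ _)) // ltnW.
Qed.

Lemma periodic_sampled x : periodic_trajectories A B C F x ->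
  LTI_trajectories (A_LTI A B C F) (fun t => x (N'.+1 * t)%N).
Proof. by move=> hx t; rewrite mulnS addnC periodic_traj_Phi. Qed.

Lemma periodic_extension phi : LTI_trajectories (A_LTI A B C F) phi ->
  exists2 x, periodic_trajectories A B C F x &
    forall t, x (N'.+1 * t)%N = phi t.
Proof.
move=> hphi; pose x k := Phi (k %% N'.+1) *m phi (k %/ N'.+1)%N.
(* Both descriptions of the time [t * N + N] agree, as [A_LTI] is [Phi N]. *)
have xE t d : (d <= N'.+1)%N -> x (t * N'.+1 + d)%N = Phi d *m phi t.
  rewrite leq_eqVlt => /predU1P [->|dN]; rewrite /x.
    by rewrite -mulSnr modnMl mulnK // /Phi Phi0 mul1mx hphi.
  by rewrite modnMDl modn_small // divnMDl // divn_small // addn0.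
exists x; last by move=> t; rewrite /x mulnC modnMl mulnK // /Phi Phi0 mul1mx.
move=> k; have dN : (k %% N'.+1 < N'.+1)%N by rewrite ltn_pmod.
rewrite {1}(divn_eq k N'.+1) -addnS xE // /Phi PhiS mulmxDl -!mulmxA mulmx_suml.
congr (_ + B *m _); apply: eq_bigr => i _.
have id : (i <= k %% N'.+1)%N by rewrite -ltnS.
have -> : (k - i = k %/ N'.+1 * N'.+1 + (k %% N'.+1 - i))%N.
  by rewrite addnBA // -divn_eq.
rewrite xE ?mulmxA //.
by rewrite (leq_trans (leq_subr _ _)) // ltnW.
Qed.

Lemma periodic_norm_le : exists2 K : R, 0 < K &
  forall x, periodic_trajectories A B C F x ->
  forall k, `|x k| <= K * `|x (N'.+1 * (k %/ N'.+1))%N|.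
Proof.
have bound (q : nat) : exists2 K : R, 0 < K &
    forall d (v : 'cV[R]_n), (d < q)%N -> `|Phi d *m v| <= K * `|v|.
  elim: q => [|q [K K0 hK]]; first by exists 1.
  have [k k0 hk] := mulmx_norm_le (Phi q).
  exists (K + k) => [|d v]; first exact: addr_gt0.
  rewrite ltnS leq_eqVlt => /predU1P [->|dq]; rewrite mulrDl.
    by apply: le_trans (hk v) _; rewrite lerDr mulr_ge0 // ltW.
  by apply: le_trans (hK _ v dq) _; rewrite lerDl mulr_ge0 // ltW.
have [K K0 hK] := bound N'.+1.
exists K => // x hx k; rewrite {1}(divn_eq k N'.+1) mulnC.
by rewrite periodic_traj_Phi ?hK ?ltn_pmod // ltnW // ltn_pmod.
Qed.

Lemma periodic_stable_LTI :
  asymptotically_stable (periodic_trajectories A B C F) <->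
  asymptotically_stable (LTI_trajectories (A_LTI A B C F)).
Proof.
split=> [[hs [c c0 hc]]|[hs [c c0 hc]]].
  split=> [e /hs [d d0 hd]|].
    exists d => // phi /periodic_extension [x hx xphi] phid t.
    rewrite -xphi; apply: hd => //.
    by have := xphi 0%N; rewrite muln0 => ->.
  exists c => // phi /periodic_extension [x hx xphi] phid.
  have xc : `|x 0%N| < c by have := xphi 0%N; rewrite muln0 => ->.
  have /cvgr0_norm_lt xlim := hc x hx xc.
  apply/cvgr0Pnorm_lt => e /xlim [M _ hM]; exists M => // t /= Mt.
  rewrite -xphi; apply: hM => /=; rewrite (leq_trans Mt) //.
  by rewrite leq_pmull.
have [K K0 hK] := periodic_norm_le.
split=> [e e0|].
  have [d d0 hd] := hs (e / K) (divr_gt0 e0 K0).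
  exists d => // x hx xd k; apply: le_lt_trans (hK x hx k) _.
  rewrite mulrC -ltr_pdivlMr //.
  apply: (hd (fun t => x (N'.+1 * t)%N)); first exact: periodic_sampled.
  by rewrite muln0.
exists c => // x hx xc.
have /cvgr0_norm_lt xlim : (fun t => x (N'.+1 * t)%N) @ \oo --> (0 : 'cV[R]_n).
  by apply: hc; [exact: periodic_sampled|rewrite muln0].
apply/cvgr0Pnorm_lt => e e0; have [M _ hM] := xlim (e / K) (divr_gt0 e0 K0).
exists (N'.+1 * M)%N => // k /= Mk; apply: le_lt_trans (hK x hx k) _.
rewrite mulrC -ltr_pdivlMr //; apply: hM => /=.
by rewrite leq_divRL // mulnC.
Qed.

End Periodic.
End Stability.

Theorem corollary1 (R : realType) (N' n m p : nat)
  (hn : (0 < n)%N) (hm : (0 < m)%N) (hp : (0 < p)%N)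
  (A : 'M[R]_n) (B : 'M[R]_(n, m)) (C : 'M[R]_(p, n))
  (hatP : 'M[R]_n) (hatJ : 'M[R]_(N'.+1 * m, N'.+1 * n))
  (hatG : 'M[R]_(N'.+1 * n))
  (ha : SF_LMI A B hatP hatJ hatG)
  (hb : (calP (A_LTI A B 1%:M (F_SF hatJ hatG)) `&` S_SOF N' A B C) !=set0) :
  (forall F : 'M[R]_(N'.+1 * m, N'.+1 * p), structured_gain F ->
     (forall x, periodic_trajectories A B C F x ->
        LTI_trajectories (A_LTI A B C F) (fun t => x (N'.+1 * t)%N)) /\
     (asymptotically_stable (periodic_trajectories A B C F) <->
      asymptotically_stable (LTI_trajectories (A_LTI A B C F)))) /\
  ((exists F : 'M[R]_(N'.+1 * m, N'.+1 * p), structured_gain F /\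
      asymptotically_stable (periodic_trajectories A B C F)) <->
   (exists (P : 'M[R]_n) (V : 'M[R]_(N'.+1 * m + N' * n))
      (F : 'M[R]_(N'.+1 * m, N'.+1 * p)),
      [/\ P^T = P, structured_gain F, posdef P &
       negdef ((Pi_mx N' A B)^T *m calX N'.+1 P 1 *m Pi_mx N' A B
         + He ((calH A B (F_SF hatJ hatG))^T *m V *m calC A B C F))])).
Proof.
split=> [F _|].
  by split; [exact: periodic_sampled|exact: periodic_stable_LTI].
split=> [_|[P [V [F [PT Fs Ppos neg]]]]].
  have [_ Ju Gu _] := ha.
  have [P [[Ppos Psf] [F [Fs _] [_ Pof]]]] := hb.
  have PT : P^T = P by case: Ppos.
  pose Q := (Pi_mx N' A B)^T *m calX N'.+1 P 1 *m Pi_mx N' A B.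
  have QT : Q^T = Q.
    rewrite /Q !trmx_mul trmxK mulmxA /calX trmx_tens PT.
    by rewrite linearD linearZ /= !trmx_mul !trmxK.
  have [V hV] : exists V : 'M[R]_(N'.+1 * m + N' * n),
      negdef (Q + He ((calH A B (F_SF hatJ hatG))^T *m V *m calC A B C F)).
    apply: projection_lemma => //.
      rewrite calH_calC; apply: negdef_on_calC_ker => //.
      exact: F_SF_structured.
    exact: negdef_on_calC_ker.
  by exists P, V, F.
exists F; split=> //; apply/periodic_stable_LTI.
exact: lyapunov_stable Ppos (LMI_lyapunov Fs PT neg).
Qed.
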